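(* Let $\alpha\in[0,1)$, $\psi_1\in(0,\infty)$, $\lambda>0$, $F_1>0$, $F_\star,\tau\ge0$. Let $\mathcal E^\infty_{R_3}$ and $\mathcal S^\infty_{R_3}$ be the explicit functions of $(\mu_0,\mu_1,\mu_2)$ given in the context, and let $\mathcal U_{R_3}$ be the set of triples $(\mu_0,\mu_1,\mu_2)$ minimizing $(1-\alpha)\mathcal E^\infty_{R_3}+\alpha\,\mathcal S^\infty_{R_3}$. Then: (i) if $\alpha=0$, or if $\psi_1=1$ and $0<\alpha\le\frac14$, then $\mathcal U_{R_3}=\{(\mu_0,\mu_1,\mu_2):\mu_\star=0\ \wedge\ \mu_1=\infty\}$, meaning that no (finite) triple attains the infimum and that the infimum is approached along triples with $\mu_\star=0$ and $\mu_1\to\infty$; (ii) if $\psi_1=1$ and $\alpha>\frac14$, then $$\mathcal U_{R_3}=\Big\{(\mu_0,\mu_1,\mu_2):\ \mu_\star=0\ \wedge\ \mu_1^2=\frac{-4\alpha^2\lambda+3\alpha\lambda+\sqrt\alpha\,\lambda}{16\alpha^2-8\alpha+1}\Big\};$$ (iii) if $\psi_1\neq1$ and $\alpha>0$, then $$\mathcal U_{R_3}=\big\{(\mu_0,\mu_1,\mu_2):\ \mu_\star=0\ \wedge\ \mu_1^2(-1+2\psi_1-x)(-1+x)+2\lambda\psi_1(1+x)=0\big\},$$ where $x$ is the unique solution of $p(x)=0$ in the range $x\in(-1,\min\{1,-1+2\psi_1\})$, with $p(x)=p_0+p_1x+p_2x^2+p_3x^3+p_4x^4$ and $$p_0=\alpha+4\psi_1(-1+2\psi_1)(-1+2\alpha),\quad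 p_1=4\big((1-4\psi_1)\alpha+2\psi_1^2\big),\quad p_2=-2\big(-3\alpha+\psi_1(2+4\alpha)\big),\quad p_3=4\alpha,\quad p_4=\alpha .$$
   Context: Triples $(\mu_0,\mu_1,\mu_2)$ range over real triples with $\mu_\star^2:=\mu_2-\mu_0^2-\mu_1^2\ge0$ (they are the moments $\mathbb E\sigma(Z)$, $\mathbb EZ\sigma(Z)$, $\mathbb E\sigma(Z)^2$, $Z\sim\mathcal N(0,1)$, of an activation function). Put $\zeta^2=\mu_1^2/\mu_\star^2$, $\overline\lambda=\lambda/\mu_\star^2$ and $$\omega_1=-\frac{\sqrt{(\psi_1\zeta^2-\zeta^2-\overline\lambda\psi_1-1)^2+4\psi_1\zeta^2(\overline\lambda\psi_1+1)}+\psi_1\zeta^2-\zeta^2-\overline\lambda\psi_1-1}{2(\overline\lambda\psi_1+1)},$$ extended by continuity to $\mu_\star=0$ (multiply numerator and denominator by $\mu_\star^2$). The asymptotic test error and sensitivity in the large sample regime are $$\mathcal E^\infty_{R_3}=F_1^2\,\frac{\frac{\omega_1^3-\omega_1^2}{\zeta^2}+\psi_1\omega_1-\psi_1}{(\psi_1-1)\omega_1^3+(1-3\psi_1)\omega_1^2+3\psi_1\omega_1-\psi_1}+F_\star^2,$$ $$\mathcal S^\infty_{R_3}=F_1^2\Big(1+\frac{2}{-1+\omega_1}+\frac{\psi_1}{\psi_1-2\omega_1\psi_1+\omega_1^2(-1+\psi_1)}\Big),$$ extended by continuity to $\mu_\star=0$ (where $1/\zeta^2=0$ for $\mu_1\neq0$)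 and to $\mu_1=0$. *)

(* Defs.v *)
From HB Require Import structures.
From mathcomp Require Import all_boot all_order all_algebra.
From mathcomp Require Import all_classical all_reals all_analysis.
From mathcomp Require Import ring lra.
Set Implicit Arguments.
Unset Strict Implicit.
Unset Printing Implicit Defensive.
Import Order.TTheory GRing.Theory Num.Theory.
Import numFieldNormedType.Exports.
Local Open Scope classical_set_scope.
Local Open Scope ring_scope.

Section Moments.
Variable R : realType.
Local Notation T := (R * R * R)%type.

Definition mu0 (t : T) : R := t.1.1.
Definition mu1 (t : T) : R := t.1.2.
Definition mu2 (t : T) : R := t.2.

Definition mustar2 (t : T) : R := mu2 t - mu0 t ^+ 2 - mu1 t ^+ 2.

Definition admissible : set T := [set t | 0 <= mustar2 t].

(* The triples at which the literal formulas below (with 1 / mustar2 and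
   1 / zeta2) involve no division by zero. *)
Definition nondegenerate : set T := [set t | 0 < mustar2 t /\ mu1 t != 0].

Definition zeta2 (t : T) : R := mu1 t ^+ 2 / mustar2 t.

Definition omega1 (psi1 lambda : R) (t : T) : R :=
  let z := zeta2 t in
  let lb := lambda / mustar2 t in
  - (Num.sqrt ((psi1 * z - z - lb * psi1 - 1) ^+ 2
                 + 4 * psi1 * z * (lb * psi1 + 1))
       + psi1 * z - z - lb * psi1 - 1)
    / (2 * (lb * psi1 + 1)).

Definition error_formula (psi1 lambda F1 Fstar : R) (t : T) : R :=
  let w := omega1 psi1 lambda t in
  F1 ^+ 2 * (((w ^+ 3 - w ^+ 2) / zeta2 t + psi1 * w - psi1)
             / ((psi1 - 1) * w ^+ 3 + (1 - 3 * psi1) * w ^+ 2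
                + 3 * psi1 * w - psi1))
  + Fstar ^+ 2.

Definition sensitivity_formula (psi1 lambda F1 : R) (t : T) : R :=
  let w := omega1 psi1 lambda t in
  F1 ^+ 2 * (1 + 2 / (- 1 + w)
             + psi1 / (psi1 - 2 * w * psi1 + w ^+ 2 * (- 1 + psi1))).

(* Extension by continuity from the nondegenerate triples. For admissible t and
   the two formulas above this is a genuine limit along a proper filter: see
   nondegenerate_dense, cvg_error_formula and cvg_sensitivity_formula. *)
Definition continuous_extension (f : T -> R) (t : T) : R :=
  lim (f @ within nondegenerate (nbhs t)).

Definition error_R3 (psi1 lambda F1 Fstar : R) : T -> R :=
  continuous_extension (error_formula psi1 lambda F1 Fstar).

Definition sensitivity_R3 (psi1 lambda F1 : R) : T -> R :=
  continuous_extension (sensitivity_formula psi1 lambda F1).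

Definition objective_R3 (alpha psi1 lambda F1 Fstar : R) (t : T) : R :=
  (1 - alpha) * error_R3 psi1 lambda F1 Fstar t
  + alpha * sensitivity_R3 psi1 lambda F1 t.

Definition minimizers_R3 (alpha psi1 lambda F1 Fstar : R) : set T :=
  [set t | admissible t /\
     forall s, admissible s ->
       objective_R3 alpha psi1 lambda F1 Fstar t
         <= objective_R3 alpha psi1 lambda F1 Fstar s].

Definition quartic (alpha psi1 x : R) : R :=
  let p0 := alpha + 4 * psi1 * (- 1 + 2 * psi1) * (- 1 + 2 * alpha) in
  let p1 := 4 * ((1 - 4 * psi1) * alpha + 2 * psi1 ^+ 2) in
  let p2 := - 2 * (- 3 * alpha + psi1 * (2 + 4 * alpha)) in
  let p3 := 4 * alpha in
  let p4 := alpha in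
  p0 + p1 * x + p2 * x ^+ 2 + p3 * x ^+ 3 + p4 * x ^+ 4.

Definition quartic_root_in_range (alpha psi1 x : R) : Prop :=
  [/\ - 1 < x, x < Num.min 1 (- 1 + 2 * psi1) & quartic alpha psi1 x = 0].

End Moments.

Section WellDefinedness.
Variable R : realType.
Local Notation T := (R * R * R)%type.
Implicit Types (t : T).

Let mu0_cont t : mu0 s @[s --> t] --> mu0 t.
Proof. by apply: (@cvg_comp _ _ _ fst fst); exact: cvg_fst. Qed.

Let mu1_cont t : mu1 s @[s --> t] --> mu1 t.
Proof. by apply: (@cvg_comp _ _ _ fst snd); [exact: cvg_fst|exact: cvg_snd]. Qed.

Let mu2_cont t : mu2 s @[s --> t] --> mu2 t.
Proof. exact: cvg_snd. Qed.

Let mustar2_cont t : mustar2 s @[s --> t] --> mustar2 t.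
Proof.
apply: cvgB; first apply: cvgB; first exact: mu2_cont.
- by apply: cvgM; exact: mu0_cont.
- by apply: cvgM; exact: mu1_cont.
Qed.

Lemma nondegenerate_dense : @admissible R `<=` closure (@nondegenerate R).
Proof.
move=> [[a b] c]; rewrite /admissible /= /mustar2 /mu2 /mu1 /mu0 /= => h.
pose b' (e : R) := b + (if 0 <= b then e else - e).
pose g (e : R) : T := ((a, b' e), c + b' e ^+ 2 - b ^+ 2 + e).
have b'c : b' e @[e --> (0 : R)] --> b.
  rewrite /b'.
  rewrite (_ : nbhs b = nbhs (b + 0)); last by rewrite addr0.
  apply: cvgD; first exact: cvg_cst.
  case: (0 <= b) => /=; first exact: cvg_id.
  have : - e @[e --> (0 : R)] --> - (0 : R) by apply: cvgN; exact: cvg_id.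
  by rewrite oppr0.
have gc : g e @[e --> (0 : R)] --> ((a, b), c).
  apply: (@cvg_pair _ _ _ _ (nbhs (a, b)) (nbhs c)).
    by apply: (@cvg_pair _ _ _ _ (nbhs a) (nbhs b)) => //; exact: cvg_cst.
  rewrite (_ : nbhs c = nbhs (c + b ^+ 2 - b ^+ 2 + 0)); last first.
    by congr nbhs; ring.
  apply: cvgD; last exact: cvg_id.
  apply: cvgB; last exact: cvg_cst.
  apply: cvgD; first exact: cvg_cst.
  by apply: cvgM.
move=> B /gc /= [e /= e0 eB].
exists (g (e / 2)); split; last first.
  by apply: eB => /=; rewrite sub0r normrN gtr0_norm; lra.
rewrite /nondegenerate /= /mustar2 /mu2 /mu1 /mu0 /=; split; first by lra.
by rewrite /b'; case: ifPn; rewrite -?ltNge => ?; [rewrite gt_eqF|rewrite lt_eqF]; lra.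
Qed.

Lemma nondegenerate_proper t :
  admissible t -> ProperFilter (within (@nondegenerate R) (nbhs t)).
Proof.
move=> /nondegenerate_dense ct; split; last exact: within_filter.
by move=> /ct [s [ns]]; exact.
Qed.

Variables (psi1 lambda F1 Fstar : R).
Hypotheses (psi1_gt0 : 0 < psi1) (lambda_gt0 : 0 < lambda).

Let b t := lambda * psi1 + mustar2 t.
Let B t := psi1 * mu1 t ^+ 2 - mu1 t ^+ 2 - lambda * psi1 - mustar2 t.
Let w t :=
  - (Num.sqrt (B t ^+ 2 + 4 * psi1 * mu1 t ^+ 2 * b t) + B t) / (2 * b t).

Let b_gt0 t : admissible t -> 0 < b t.
Proof. by rewrite /admissible /= /b => ?; rewrite ltr_wpDr ?mulr_gt0. Qed.

Let disc_ge0 t : admissible t -> B t ^+ 2 <= B t ^+ 2 + 4 * psi1 * mu1 t ^+ 2 * b t.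
Proof.
move=> /b_gt0/ltW ?; rewrite lerDl mulr_ge0//.
by apply: mulr_ge0; [apply: mulr_ge0 => //; exact: ltW|exact: sqr_ge0].
Qed.

Let w_le0 t : admissible t -> w t <= 0.
Proof.
move=> at_; rewrite /w mulNr oppr_le0 divr_ge0 //; last first.
  by rewrite mulr_ge0// ltW// b_gt0.
have /ler_wsqrtr := disc_ge0 at_; rewrite sqrtr_sqr => hs.
have hB : - B t <= `|B t| by rewrite -normrN ler_norm.
by rewrite -lerBlDr sub0r (le_trans hB).
Qed.

Let w_eq t : admissible t ->
  b t * (w t ^+ 2 - w t) = mu1 t ^+ 2 * (psi1 - (psi1 - 1) * w t).
Proof.
move=> at_; have b0 := b_gt0 at_.
set s := Num.sqrt (B t ^+ 2 + 4 * psi1 * mu1 t ^+ 2 * b t).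
have s2 : s ^+ 2 = B t ^+ 2 + 4 * psi1 * mu1 t ^+ 2 * b t.
  by rewrite sqr_sqrtr// (le_trans (sqr_ge0 (B t)))// disc_ge0.
have ws : s = - (2 * b t) * w t - B t.
  by rewrite /w -/s; field; rewrite gt_eqF.
have BE : B t = (psi1 - 1) * mu1 t ^+ 2 - b t by rewrite /B /b; ring.
have : (4 * b t) * (b t * w t ^+ 2 + B t * w t - psi1 * mu1 t ^+ 2) = 0.
  transitivity ((- (2 * b t) * w t - B t) ^+ 2
     - (B t ^+ 2 + 4 * psi1 * mu1 t ^+ 2 * b t)); first by ring.
  by rewrite -ws s2 subrr.
move=> /eqP; rewrite !mulf_eq0 pnatr_eq0 /= gt_eqF//= => /eqP.
by rewrite BE => h; apply/eqP; rewrite -subr_eq0 -[X in _ == X]h; apply/eqP; ring.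
Qed.

Let Q_gt0 t : admissible t ->
  0 < psi1 - 2 * w t * psi1 + w t ^+ 2 * (- 1 + psi1).
Proof.
move=> at_; have b0 := b_gt0 at_; have w0 := w_le0 at_; have e := w_eq at_.
have [->|wn0] := eqVneq (w t) 0.
  by rewrite [ltRHS](_ : _ = psi1) //; ring.
have wlt0 : w t < 0 by rewrite lt_neqAle wn0.
have k0 : 0 < psi1 - (psi1 - 1) * w t.
  have : 0 < b t * (w t ^+ 2 - w t) by rewrite mulr_gt0//; nra.
  rewrite e => h; rewrite -(pmulr_rgt0 _ (x := mu1 t ^+ 2))//.
  by rewrite lt0r sqr_ge0 andbT; apply: contraTneq h => ->; rewrite mul0r ltxx.
rewrite [ltRHS](_ : _ = (psi1 - (psi1 - 1) * w t) * (1 - w t) - w t); last by ring.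
by rewrite subr_gt0 (lt_trans wlt0)// mulr_gt0//; lra.
Qed.

Let den_neq0 t : admissible t ->
  (psi1 - 1) * w t ^+ 3 + (1 - 3 * psi1) * w t ^+ 2 + 3 * psi1 * w t - psi1 != 0.
Proof.
move=> at_; rewrite [X in X != 0](_ : _ = (w t - 1) *
  (psi1 - 2 * w t * psi1 + w t ^+ 2 * (- 1 + psi1))); last by ring.
have w0 := w_le0 at_; apply: mulf_neq0; last by rewrite gt_eqF// Q_gt0.
by rewrite lt_eqF//; lra.
Qed.

Let w_cont t : admissible t -> w s @[s --> t] --> w t.
Proof.
move=> at_; have b0 := b_gt0 at_.
have bc : b s @[s --> t] --> b t.
  by apply: cvgD; [exact: cvg_cst|exact: mustar2_cont].
have ac : mu1 s ^+ 2 @[s --> t] --> mu1 t ^+ 2 by apply: cvgM; exact: mu1_cont.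
have Bc : B s @[s --> t] --> B t.
  apply: cvgB; last exact: mustar2_cont.
  apply: cvgB; last exact: cvg_cst.
  by apply: cvgB => //; apply: cvgM => //; exact: cvg_cst.
apply: cvgM; last first.
  apply: cvgV; first by rewrite mulf_neq0// gt_eqF.
  by apply: cvgM => //; exact: cvg_cst.
apply: cvgN; apply: cvgD => //.
apply: continuous_cvg; first exact: sqrt_continuous.
apply: cvgD; first by apply: cvgM.
by do 2?apply: cvgM => //; exact: cvg_cst.
Qed.

Let omega1E t : nondegenerate t -> omega1 psi1 lambda t = w t.
Proof.
move=> [m0 _]; have b0 : 0 < b t by apply: b_gt0; exact: ltW.
have mn0 : mustar2 t != 0 by rewrite gt_eqF.
rewrite /omega1 /zeta2.
rewrite (_ : _ ^+ 2 + _ =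
  (B t ^+ 2 + 4 * psi1 * mu1 t ^+ 2 * b t) / mustar2 t ^+ 2); last first.
  by rewrite /B /b; field.
rewrite sqrtrM; last first.
  by rewrite (le_trans (sqr_ge0 (B t)))// disc_ge0//; exact: ltW.
rewrite sqrtrV ?sqr_ge0// sqrtr_sqr (gtr0_norm m0) /w.
move: (Num.sqrt _) => s; rewrite /B /b; field.
by rewrite mn0 /= -/(b t) gt_eqF.
Qed.

(* The values at admissible t of the extensions by continuity. *)
Let Ebar t := F1 ^+ 2 *
  ((w t * mustar2 t * (psi1 - (psi1 - 1) * w t) / b t + psi1 * w t - psi1)
    / ((psi1 - 1) * w t ^+ 3 + (1 - 3 * psi1) * w t ^+ 2 + 3 * psi1 * w t - psi1))
  + Fstar ^+ 2.

Let Sbar t := F1 ^+ 2 * (1 + 2 / (- 1 + w t)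
             + psi1 / (psi1 - 2 * w t * psi1 + w t ^+ 2 * (- 1 + psi1))).

Let Ebar_cvg t : admissible t ->
  error_formula psi1 lambda F1 Fstar s @[s --> within (@nondegenerate R) (nbhs t)]
    --> Ebar t.
Proof.
move=> at_; have b0 := b_gt0 at_.
have wc := w_cont at_.
have cW (f : T -> R) (l : R) : f s @[s --> t] --> l ->
    f s @[s --> within (@nondegenerate R) (nbhs t)] --> l.
  by move=> fl; apply: cvg_trans fl; apply: cvg_app; exact: cvg_within.
have w2c : w s ^+ 2 @[s --> t] --> w t ^+ 2 by apply: cvgM.
have w3c : w s ^+ 3 @[s --> t] --> w t ^+ 3 by apply: cvgM => //; apply: cvgM.
have Ec : Ebar s @[s --> t] --> Ebar t.
  apply: cvgD; last exact: cvg_cst.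
  apply: cvgM; first exact: cvg_cst.
  apply: cvgM; last first.
    apply: cvgV; first by rewrite den_neq0.
    apply: cvgB; last exact: cvg_cst.
    apply: cvgD; last by apply: cvgM => //; exact: cvg_cst.
    by apply: cvgD; apply: cvgM => //; exact: cvg_cst.
  apply: cvgB; last exact: cvg_cst.
  apply: cvgD; last by apply: cvgM => //; exact: cvg_cst.
  apply: cvgM; last first.
    apply: cvgV; first by rewrite gt_eqF.
    by apply: cvgD; [exact: cvg_cst|exact: mustar2_cont].
  apply: cvgM; first by apply: cvgM => //; exact: mustar2_cont.
  apply: cvgB; first exact: cvg_cst.
  by apply: cvgM => //; exact: cvg_cst.
apply: cvg_trans (cW _ _ Ec); apply: near_eq_cvg.
near=> s.
have ns : nondegenerate s by near: s; exact: withinT.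
have as_ : admissible s by case: ns => /ltW.
case: (ns) => m0 a0; rewrite /error_formula omega1E// /Ebar.
congr (_ * ((_ + _ - _) / _) + _).
have e := w_eq as_; have bs0 := b_gt0 as_.
have -> : psi1 - (psi1 - 1) * w s = b s * (w s ^+ 2 - w s) / mu1 s ^+ 2.
  by rewrite e; field; rewrite a0.
rewrite /zeta2; field.
by rewrite a0 !gt_eqF.
Unshelve. all: by end_near. Qed.

Let Sbar_cvg t : admissible t ->
  sensitivity_formula psi1 lambda F1 s
    @[s --> within (@nondegenerate R) (nbhs t)] --> Sbar t.
Proof.
move=> at_; have wc := w_cont at_; have w0 := w_le0 at_.
have w2c : w s ^+ 2 @[s --> t] --> w t ^+ 2 by apply: cvgM.
have Sc : Sbar s @[s --> t] --> Sbar t.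
  apply: cvgM; first exact: cvg_cst.
  apply: cvgD.
    apply: cvgD; first exact: cvg_cst.
    apply: cvgM; first exact: cvg_cst.
    apply: cvgV; first by rewrite lt_eqF//; lra.
    by apply: cvgD => //; exact: cvg_cst.
  apply: cvgM; first exact: cvg_cst.
  apply: cvgV; first by rewrite gt_eqF// Q_gt0.
  apply: cvgD; last by apply: cvgM => //; exact: cvg_cst.
  apply: cvgB; first exact: cvg_cst.
  apply: cvgM; last exact: cvg_cst.
  by apply: cvgM => //; exact: cvg_cst.
have {}Sc : Sbar s @[s --> within (@nondegenerate R) (nbhs t)] --> Sbar t.
  by apply: cvg_trans Sc; apply: cvg_app; exact: cvg_within.
apply: cvg_trans Sc; apply: near_eq_cvg.
near=> s.
have ns : nondegenerate s by near: s; exact: withinT.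
by rewrite /sensitivity_formula omega1E.
Unshelve. all: by end_near. Qed.

Lemma cvg_error_formula t : admissible t ->
  error_formula psi1 lambda F1 Fstar s @[s --> within (@nondegenerate R) (nbhs t)]
    --> error_R3 psi1 lambda F1 Fstar t.
Proof. by move=> /Ebar_cvg h; apply/cvg_ex; exists (Ebar t). Qed.

Lemma cvg_sensitivity_formula t : admissible t ->
  sensitivity_formula psi1 lambda F1 s
    @[s --> within (@nondegenerate R) (nbhs t)] --> sensitivity_R3 psi1 lambda F1 t.
Proof. by move=> /Sbar_cvg h; apply/cvg_ex; exists (Sbar t). Qed.

End WellDefinedness.

(* Main.v *)
Require Import Defs.
From HB Require Import structures.
From mathcomp Require Import all_boot all_order all_algebra.
From mathcomp Require Import all_classical all_reals all_analysis.
From mathcomp Require Import ring lra.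
Set Implicit Arguments.
Unset Strict Implicit.
Unset Printing Implicit Defensive.
Import Order.TTheory GRing.Theory Num.Theory.
Import numFieldNormedType.Exports.
Local Open Scope classical_set_scope.
Local Open Scope ring_scope.

(** In the variable y = omega_1 / (omega_1 - 1), which lies in
    [0, min(1, psi_1)) and solves
    mu_1^2 (psi_1 - y) (1 - y) = (lambda psi_1 + mu_star^2) y, the objective is
    F_1^2 (phi(y) + alpha (2y - 1) + (1 - alpha) r) + (1 - alpha) F_star^2
    with phi(y) = psi_1 (1 - y)^2 / (psi_1 - y^2) strictly convex and a remainder
    r >= 0 that, for y > 0, vanishes only when mu_star = 0. Since mu_star = 0
    alone realizes every y in the range, one minimizes phi(y) + 2 alpha y:
    either it decreases strictly and the infimum is approached as mu_1 -> oo, or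
    it has a unique critical point, whose equation is the quartic in x = 2y - 1. *)

(** * Strict convexity of the term shared by error and sensitivity *)

Lemma sqrB_gt0 (R : realType) (psi y : R) :
  0 <= y -> y < 1 -> y < psi -> 0 < psi - y ^+ 2.
Proof. by move=> y0 y1 yp; nra. Qed.

(** This is [phi] of the overview. It enters both the error and the sensitivity with the same
    coefficient, so its weight in the objective does not depend on [alpha]. *)
Definition ridge (R : realType) (psi y : R) : R :=
  psi * (1 - y) ^+ 2 / (psi - y ^+ 2).

(* The derivative of [ridge psi]. *)
Definition slope (R : realType) (psi y : R) : R :=
  - 2 * psi * (1 - y) * (psi - y) / (psi - y ^+ 2) ^+ 2.

(** Strict convexity in tangent-line form: the gap to the tangent is [(y - z) ^+ 2] times a factor
    whose positivity is elementary. *)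
Lemma ridge_tangent (R : realType) (psi y z : R) :
  0 <= y -> y < 1 -> y < psi -> 0 <= z -> z < 1 -> z < psi -> y != z ->
  ridge psi z + slope psi z * (y - z) < ridge psi y.
Proof.
move=> y0 y1 yp z0 z1 zp yz; rewrite /ridge /slope.
have Dy := sqrB_gt0 y0 y1 yp; have Dz := sqrB_gt0 z0 z1 zp.
have psi0 : 0 < psi by exact: le_lt_trans yp.
rewrite -subr_gt0.
rewrite [ltRHS](_ : _ = psi * ((y - z) ^+ 2 *
  ((psi - z ^+ 2) ^+ 2 + (1 - z) ^+ 2 * (psi - z ^+ 2)
   - 2 * (1 - z) * (psi - z) * (z + y)))
  / ((psi - y ^+ 2) * (psi - z ^+ 2) ^+ 2)); last first.
  by field; rewrite !gt_eqF.
rewrite divr_gt0//; last by rewrite mulr_gt0// exprn_gt0.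
rewrite mulr_gt0//; rewrite mulr_gt0//.
  by rewrite lt0r sqr_ge0 andbT expf_neq0// subr_eq0.
set p := 1 - z; set q := psi - z; set d := y - z.
have p0 : 0 < p by rewrite subr_gt0.
have q0 : 0 < q by rewrite subr_gt0.
have dp : d < p by rewrite ltrD2r.
have dq : d < q by rewrite ltrD2r.
(* Since [d < p] and [d < q], the first summand is positive. The last bracket is at least
   [(2 * q - p) * (q - p)] when [p <= q], and at least [p * (p - q)] when [q < p]. *)
rewrite [ltRHS](_ : _ = p ^+ 2 * q * ((p - d) + (q - d))
   + z * (z * (p - q) ^+ 2 + p * (2 * q ^+ 2 + p ^+ 2 - p * q - 2 * q * d)));
  last by rewrite /p /q /d; ring.
rewrite ltr_wpDr//.
  rewrite mulr_ge0// addr_ge0//; first by rewrite mulr_ge0// sqr_ge0.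
  rewrite mulr_ge0//; first exact: ltW.
  by have [pq|pq] := leP p q; nra.
by rewrite mulr_gt0 ?mulr_gt0 ?exprn_gt0//; lra.
Qed.

(** * The spectral variable and its quadratic equation *)

Section SpectralVariable.
Variables (R : realType) (psi lambda : R).
Hypotheses (psi_gt0 : 0 < psi) (lambda_gt0 : 0 < lambda).
Local Notation T := (R * R * R)%type.
Implicit Types t : T.

Definition shift t : R := lambda * psi + mustar2 t.

Definition discr t : R :=
  (mu1 t ^+ 2 * (psi - 1) - shift t) ^+ 2 + 4 * psi * mu1 t ^+ 2 * shift t.

(** For [mu1 t != 0] this is the smaller root of the quadratic in [spectral_eq], with the square
    root moved to the denominator. That denominator stays positive when [mu1] or [mustar2] vanishes,
    so both degenerate cases are covered. *)
Definition spectral t : R :=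
  2 * psi * mu1 t ^+ 2
    / (mu1 t ^+ 2 * (1 + psi) + shift t + Num.sqrt (discr t)).

Lemma shift_gt0 t : admissible t -> 0 < shift t.
Proof. by rewrite /admissible /= /shift => ?; rewrite ltr_wpDr// mulr_gt0. Qed.

Lemma discr_ge0 t : admissible t -> 0 <= discr t.
Proof.
move=> /shift_gt0 b0; rewrite addr_ge0 ?sqr_ge0//.
by rewrite !(sqr_ge0, mulr_ge0)// ltW.
Qed.

(** [discr t] exceeds the squares of the two left-hand sides by nonnegative multiples of
    [mu1 t ^+ 2 * shift t]. The first bound gives [spectral_lt_psi], the second [spectral_lt1]. *)
Lemma sqrt_discr_ge t : admissible t ->
  mu1 t ^+ 2 * (1 - psi) + shift t <= Num.sqrt (discr t) /\
  mu1 t ^+ 2 * (psi - 1) + shift t <= Num.sqrt (discr t).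
Proof.
move=> at_; have b0 := shift_gt0 at_.
have a0 : 0 <= mu1 t ^+ 2 by exact: sqr_ge0.
have le_sqrt (e : R) : e ^+ 2 <= discr t -> e <= Num.sqrt (discr t).
  move=> /ler_wsqrtr; rewrite sqrtr_sqr; exact/le_trans/ler_norm.
have ab : 0 <= mu1 t ^+ 2 * shift t by rewrite mulr_ge0// ltW.
split; apply: le_sqrt; rewrite /discr -subr_ge0.
  rewrite [leRHS](_ : _ = 4 * psi * (mu1 t ^+ 2 * shift t)); last by ring.
  by rewrite mulr_ge0// mulr_ge0// ltW.
rewrite [leRHS](_ : _ = 4 * (mu1 t ^+ 2 * shift t)); last by ring.
by rewrite mulr_ge0.
Qed.

Lemma spectral_den_gt0 t : admissible t ->
  0 < mu1 t ^+ 2 * (1 + psi) + shift t + Num.sqrt (discr t).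
Proof.
move=> at_; rewrite ltr_wpDr ?sqrtr_ge0// ltr_wpDl ?shift_gt0//.
by rewrite mulr_ge0 ?sqr_ge0// addr_ge0// ltW.
Qed.

Lemma spectral_ge0 t : admissible t -> 0 <= spectral t.
Proof.
move=> at_; rewrite divr_ge0 ?(ltW (spectral_den_gt0 at_))//.
by rewrite !(sqr_ge0, mulr_ge0)// ltW.
Qed.

Lemma spectral_lt1 t : admissible t -> spectral t < 1.
Proof.
move=> at_; rewrite ltr_pdivrMr ?spectral_den_gt0// mul1r.
by have [_] := sqrt_discr_ge at_; have := shift_gt0 at_; lra.
Qed.

Lemma spectral_lt_psi t : admissible t -> spectral t < psi.
Proof.
move=> at_; rewrite ltr_pdivrMr ?spectral_den_gt0//.
rewrite [ltLHS](_ : _ = psi * (2 * mu1 t ^+ 2)); last by ring.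
rewrite ltr_pM2l//.
by have [+ _] := sqrt_discr_ge at_; have := shift_gt0 at_; lra.
Qed.

Lemma spectral_eq t : admissible t ->
  mu1 t ^+ 2 * (psi - spectral t) * (1 - spectral t) = shift t * spectral t.
Proof.
move=> at_; have d0 := spectral_den_gt0 at_.
have r2 : Num.sqrt (discr t) ^+ 2 = discr t by rewrite sqr_sqrtr ?discr_ge0.
apply/eqP; rewrite -subr_eq0 /spectral; move: r2 d0.
rewrite {2}/discr; move: (Num.sqrt _) => r r2 d0; apply/eqP.
rewrite [LHS](_ : _ = psi * mu1 t ^+ 2 *
  (r ^+ 2 - ((mu1 t ^+ 2 * (psi - 1) - shift t) ^+ 2 +
     4 * psi * mu1 t ^+ 2 * shift t))
  / (mu1 t ^+ 2 * (1 + psi) + shift t + r) ^+ 2); last by field; rewrite gt_eqF.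
by rewrite r2 subrr mulr0 mul0r.
Qed.

(** Up to [min(1, psi)] the right side of the inequality is nonincreasing in [z] and the left side
    increasing; they cross at [spectral t]. *)
Lemma spectral_lt t z : admissible t -> 0 <= z -> z < 1 -> z < psi ->
  shift t * z < mu1 t ^+ 2 * (psi - z) * (1 - z) -> z < spectral t.
Proof.
move=> at_ z0 z1 zp; apply: contraTT; rewrite -!leNgt => le_yz.
have y0 := spectral_ge0 at_; have b0 := shift_gt0 at_.
apply: (@le_trans _ _ (shift t * spectral t)); last by rewrite ler_pM2l.
rewrite -spectral_eq// -mulrA -[leRHS]mulrA ler_wpM2l ?sqr_ge0//.
by apply: ler_pM; lra.
Qed.

Lemma spectral_uniq t z : admissible t -> 0 <= z -> z < 1 -> z < psi ->
  mu1 t ^+ 2 * (psi - z) * (1 - z) = shift t * z -> spectral t = z.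
Proof.
move=> at_ z0 z1 zp e.
have y0 := spectral_ge0 at_; have b0 := shift_gt0 at_.
have y1 := spectral_lt1 at_; have yp := spectral_lt_psi at_.
have ye := spectral_eq at_.
apply/eqP; rewrite -subr_eq0; apply/eqP.
(* The two quadratic equations subtract to this factor times [spectral t - z]. *)
have k0 : 0 < shift t + mu1 t ^+ 2 * (1 - z + (psi - spectral t)).
  by rewrite ltr_wpDr// mulr_ge0 ?sqr_ge0//; lra.
apply: (mulfI (lt0r_neq0 k0)); rewrite mulr0.
transitivity ((mu1 t ^+ 2 * (psi - z) * (1 - z) - shift t * z)
  - (mu1 t ^+ 2 * (psi - spectral t) * (1 - spectral t)
     - shift t * spectral t)); first by ring.
by rewrite e ye !subrr.
Qed.

Lemma spectral_gt0 t : admissible t -> mu1 t != 0 -> 0 < spectral t.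
Proof.
move=> at_ a0; rewrite divr_gt0 ?spectral_den_gt0//.
by rewrite mulr_gt0 ?exprn_even_gt0// mulr_gt0.
Qed.

Lemma spectral_surj z : 0 <= z -> z < 1 -> z < psi ->
  exists t, [/\ admissible t, mustar2 t = 0 & spectral t = z].
Proof.
(* [a] is the value of [mu1 ^+ 2] that solves the spectral equation when [mustar2] is zero. *)
move=> z0 z1 zp; pose a := lambda * psi * z / ((psi - z) * (1 - z)).
have a0 : 0 <= a.
  by rewrite divr_ge0 ?mulr_ge0 ?subr_ge0 ?(ltW psi_gt0) ?(ltW lambda_gt0)// ltW.
pose t : T := ((0, Num.sqrt a), a).
have s0 : mustar2 t = 0.
  by rewrite /mustar2 /mu0 /mu1 /mu2 /= sqr_sqrtr//; ring.
have at_ : admissible t by rewrite /admissible /= s0.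
exists t; split => //; apply: spectral_uniq => //.
rewrite /shift s0 /mu1 /= sqr_sqrtr// /a; field.
by rewrite !subr_eq0 !gt_eqF.
Qed.

(** This inverts the change of variable of the overview. Once [mustar2] is cleared, the two
    fractions are conjugate forms of one root, and cross-multiplying leaves only the identity
    defining the square root of [discr t]. *)
Lemma omega1E t : Defs.nondegenerate t ->
  omega1 psi lambda t = - spectral t / (1 - spectral t).
Proof.
move=> [s0 a0]; have at_ : admissible t by exact: ltW.
have sn0 : mustar2 t != 0 by rewrite gt_eqF.
have b0 := shift_gt0 at_; have d0 := spectral_den_gt0 at_.
have rB : 0 < mu1 t ^+ 2 * (1 - psi) + shift t + Num.sqrt (discr t).
  by have [_] := sqrt_discr_ge at_; lra.
have -> : - spectral t / (1 - spectral t) = - (2 * psi * mu1 t ^+ 2)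
    / (mu1 t ^+ 2 * (1 - psi) + shift t + Num.sqrt (discr t)).
  rewrite /spectral; field; rewrite (lt0r_neq0 d0) andbT.
  exact: (lt0r_neq0 rB).
rewrite /omega1 /zeta2.
rewrite (_ : _ ^+ 2 + _ = discr t / mustar2 t ^+ 2); last first.
  by rewrite /discr /shift; field.
rewrite sqrtrM ?discr_ge0// sqrtrV ?sqr_ge0// sqrtr_sqr (gtr0_norm s0).
have r2 : Num.sqrt (discr t) ^+ 2 = discr t by rewrite sqr_sqrtr ?discr_ge0.
move: rB r2; rewrite {2}/discr; move: (Num.sqrt _) => r rB r2.
transitivity (- (r + mu1 t ^+ 2 * (psi - 1) - shift t) / (2 * shift t)).
  rewrite /shift; field; rewrite sn0 /= -/(shift t).
  by rewrite gt_eqF.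
apply/eqP; rewrite eqr_div ?(lt0r_neq0 rB) ?mulf_neq0 ?(lt0r_neq0 b0)//.
rewrite -subr_eq0; apply/eqP.
transitivity ((mu1 t ^+ 2 * (psi - 1) - shift t) ^+ 2 +
     4 * psi * mu1 t ^+ 2 * shift t - r ^+ 2); first by ring.
by rewrite r2 subrr.
Qed.

(** * Extension by continuity and closed forms of error and sensitivity *)

Lemma cvg_mu1 t : mu1 s @[s --> t] --> mu1 t.
Proof. by apply: (@cvg_comp _ _ _ fst snd); [exact: cvg_fst|exact: cvg_snd]. Qed.

Lemma cvg_mustar2 t : mustar2 s @[s --> t] --> mustar2 t.
Proof.
apply: cvgB; last by apply: cvgM; exact: cvg_mu1.
apply: cvgB; first exact: cvg_snd.
by apply: cvgM; apply: (@cvg_comp _ _ _ fst fst); exact: cvg_fst.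
Qed.

Lemma cvg_shift t : shift s @[s --> t] --> shift t.
Proof. by apply: cvgD; [exact: cvg_cst|exact: cvg_mustar2]. Qed.

Lemma cvg_spectral t : admissible t -> spectral s @[s --> t] --> spectral t.
Proof.
move=> at_; have bc := @cvg_shift t.
have ac : mu1 s ^+ 2 @[s --> t] --> mu1 t ^+ 2 by apply: cvgM; exact: cvg_mu1.
have Bc : mu1 s ^+ 2 * (psi - 1) - shift s @[s --> t]
    --> mu1 t ^+ 2 * (psi - 1) - shift t.
  by apply: cvgB => //; apply: cvgM => //; exact: cvg_cst.
apply: cvgM; first by apply: cvgM => //; exact: cvg_cst.
apply: cvgV; first by rewrite gt_eqF// spectral_den_gt0.
apply: cvgD; first by apply: cvgD => //; apply: cvgM => //; exact: cvg_cst.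
apply: continuous_cvg; first exact: sqrt_continuous.
apply: cvgD; first by apply: cvgM.
by do 2?apply: cvgM => //; exact: cvg_cst.
Qed.

(** The limit defining the extension is along a proper filter, hence unique, so any [g] continuous
    at [t] that agrees with [f] on nondegenerate triples gives its value. *)
Lemma continuous_extensionE (f g : T -> R) t : admissible t ->
  (forall s, Defs.nondegenerate s -> f s = g s) -> g s @[s --> t] --> g t ->
  continuous_extension f t = g t.
Proof.
move=> at_ fg gc.
have pf := nondegenerate_proper at_.
apply: cvg_lim => //.
apply: (@cvg_trans _ (g s @[s --> within (@Defs.nondegenerate R) (nbhs t)])).
  apply: near_eq_cvg; near=> s.
  by rewrite fg//; near: s; exact: withinT.
by apply: cvg_trans gc; apply: cvg_app; exact: cvg_within.
Unshelve. all: by end_near. Qed.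

(* The part of the test error that is due to [mustar2 t > 0]. *)
Definition excess t : R := spectral t * mustar2 t * (psi - spectral t)
  * (1 - spectral t) / shift t / (psi - spectral t ^+ 2).

Lemma excess_ge0 t : admissible t -> 0 <= excess t.
Proof.
move=> at_; have y0 := spectral_ge0 at_.
have y1 := spectral_lt1 at_; have yp := spectral_lt_psi at_.
have D0 := sqrB_gt0 y0 y1 yp; have b0 := shift_gt0 at_.
rewrite /excess divr_ge0 ?(ltW D0)// divr_ge0 ?(ltW b0)//.
by rewrite mulr_ge0 ?subr_ge0 ?(ltW y1)// mulr_ge0 ?subr_ge0 ?(ltW yp)// mulr_ge0.
Qed.

Lemma excess_eq0 t : admissible t -> 0 < spectral t -> excess t = 0 ->
  mustar2 t = 0.
Proof.
move=> at_ y0.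
have y1 := spectral_lt1 at_; have yp := spectral_lt_psi at_.
have D0 := sqrB_gt0 (ltW y0) y1 yp; have b0 := shift_gt0 at_.
rewrite /excess; move: (mustar2 t) (shift t) (spectral t) b0 y0 y1 yp D0.
move=> s b y b0 y0 y1 yp D0 /eqP.
rewrite !mulf_eq0 !invr_eq0 !subr_eq0.
rewrite (gt_eqF y0) (gt_eqF yp) (gt_eqF y1) (gt_eqF b0) /=.
by rewrite -(subr_eq0 psi) (gt_eqF D0) !orbF => /eqP.
Qed.

Lemma error_R3E F1 Fstar t : admissible t -> error_R3 psi lambda F1 Fstar t =
  F1 ^+ 2 * (ridge psi (spectral t) + excess t) + Fstar ^+ 2.
Proof.
move=> at_; apply: (continuous_extensionE
    (g := fun t => F1 ^+ 2 * (ridge psi (spectral t) + excess t) + Fstar ^+ 2)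
    at_).
  move=> s ns; have as_ : admissible s by case: ns => /ltW.
  case: (ns) => s0 a0; have y0 := spectral_gt0 as_ a0.
  have y1 := spectral_lt1 as_; have yp := spectral_lt_psi as_.
  have D0 := sqrB_gt0 (ltW y0) y1 yp; have b0 := shift_gt0 as_.
  have -> : error_formula psi lambda F1 Fstar s = F1 ^+ 2 * ((
     (omega1 psi lambda s ^+ 3 - omega1 psi lambda s ^+ 2)
       * (mustar2 s / mu1 s ^+ 2) + psi * omega1 psi lambda s - psi)
     / ((psi - 1) * omega1 psi lambda s ^+ 3
        + (1 - 3 * psi) * omega1 psi lambda s ^+ 2
        + 3 * psi * omega1 psi lambda s - psi)) + Fstar ^+ 2.
    by rewrite /error_formula /zeta2 invf_div.
  (* Eliminating [mu1 s ^+ 2] turns the inverse of [zeta2] into a multiple of the inverse of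
     [spectral s]. The factor [omega1 ^+ 2] absorbs it, so [excess] is regular at [mu1 = 0]. *)
  have -> : mu1 s ^+ 2 = shift s * spectral s
      / ((psi - spectral s) * (1 - spectral s)).
    by rewrite -spectral_eq// -[X in X / _]mulrA mulfK// mulf_neq0// lt0r_neq0// subr_gt0.
  rewrite omega1E// /ridge /excess; congr (_ * _ + _).
  move: y0 y1 yp D0; move: (spectral s) => y y0 y1 yp D0.
  have p0 : 1 - y != 0 by rewrite subr_eq0 gt_eqF.
  have q0 : psi - y != 0 by rewrite subr_eq0 gt_eqF.
  rewrite (_ : _ + 3 * psi * _ - psi = - (psi - y ^+ 2) / (1 - y) ^+ 3);
    last by field.
  field; rewrite p0 q0 (gt_eqF D0) (gt_eqF b0) (gt_eqF y0) /=.
  by rewrite ?andbT// ?oppr_eq0 ?(gt_eqF D0).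
have yc := cvg_spectral at_.
have y0 := spectral_ge0 at_; have b0 := shift_gt0 at_.
have y1 := spectral_lt1 at_; have yp := spectral_lt_psi at_.
have D0 := sqrB_gt0 y0 y1 yp.
have Dc : (psi - spectral s ^+ 2)^-1 @[s --> t] --> (psi - spectral t ^+ 2)^-1.
  apply: cvgV; first by rewrite gt_eqF.
  by apply: cvgB; [exact: cvg_cst|apply: cvgM].
have pc : 1 - spectral s @[s --> t] --> 1 - spectral t.
  by apply: cvgB => //; exact: cvg_cst.
apply: cvgD; last exact: cvg_cst.
apply: cvgM; first exact: cvg_cst.
apply: cvgD.
  apply: cvgM => //; apply: cvgM; first exact: cvg_cst.
  by apply: cvgM.
apply: cvgM => //; apply: cvgM; last first.
  by apply: cvgV; [rewrite gt_eqF|exact: cvg_shift].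
apply: cvgM => //; apply: cvgM; first by apply: cvgM => //; exact: cvg_mustar2.
by apply: cvgB => //; exact: cvg_cst.
Qed.

Lemma sensitivity_R3E F1 t : admissible t -> sensitivity_R3 psi lambda F1 t =
  F1 ^+ 2 * (ridge psi (spectral t) + (2 * spectral t - 1)).
Proof.
move=> at_; apply: (continuous_extensionE
    (g := fun t => F1 ^+ 2 * (ridge psi (spectral t) + (2 * spectral t - 1)))
    at_).
  move=> s ns; have as_ : admissible s by case: ns => /ltW.
  have y0 := spectral_ge0 as_.
  have y1 := spectral_lt1 as_; have yp := spectral_lt_psi as_.
  have D0 := sqrB_gt0 y0 y1 yp.
  rewrite /sensitivity_formula omega1E// /ridge; congr (_ * _).
  move: y0 y1 yp D0; move: (spectral s) => y y0 y1 yp D0.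
  have p0 : 1 - y != 0 by rewrite subr_eq0 gt_eqF.
  rewrite (_ : psi - _ + _ = (psi - y ^+ 2) / (1 - y) ^+ 2); last by field.
  rewrite (_ : - 1 + - y / (1 - y) = - 1 / (1 - y)); last by field.
  by field; rewrite p0 gt_eqF.
have yc := cvg_spectral at_.
have y0 := spectral_ge0 at_.
have y1 := spectral_lt1 at_; have yp := spectral_lt_psi at_.
have D0 := sqrB_gt0 y0 y1 yp.
have pc : 1 - spectral s @[s --> t] --> 1 - spectral t.
  by apply: cvgB => //; exact: cvg_cst.
apply: cvgM; first exact: cvg_cst.
apply: cvgD.
  apply: cvgM; first by apply: cvgM; [exact: cvg_cst|apply: cvgM].
  apply: cvgV; first by rewrite gt_eqF.
  by apply: cvgB; [exact: cvg_cst|apply: cvgM].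
by apply: cvgB; [apply: cvgM => //; exact: cvg_cst|exact: cvg_cst].
Qed.

Lemma objective_R3E alpha F1 Fstar t : admissible t ->
  objective_R3 alpha psi lambda F1 Fstar t =
  F1 ^+ 2 * (ridge psi (spectral t) + alpha * (2 * spectral t - 1)
             + (1 - alpha) * excess t) + (1 - alpha) * Fstar ^+ 2.
Proof. by move=> ?; rewrite /objective_R3 error_R3E// sensitivity_R3E//; ring. Qed.

End SpectralVariable.

(** * Critical points of the convex profile and the quartic *)

Lemma slope_crit (R : realType) (psi alpha y : R) :
  0 <= y -> y < 1 -> y < psi ->
  slope psi y + 2 * alpha =
  2 * (alpha * (psi - y ^+ 2) ^+ 2 - psi * (1 - y) * (psi - y))
    / (psi - y ^+ 2) ^+ 2.
Proof.
move=> y0 y1 yp; rewrite /slope; field.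
by rewrite gt_eqF// sqrB_gt0.
Qed.

Lemma quarticE (R : realType) (alpha psi y : R) :
  quartic alpha psi (2 * y - 1) =
  16 * (alpha * (psi - y ^+ 2) ^+ 2 - psi * (1 - y) * (psi - y)).
Proof. by rewrite /quartic; ring. Qed.

(** With [x = 2 * y - 1] the range becomes [0 < y < min(1, psi)], where the denominator in
    [slope_crit] is positive and the quartic is a positive multiple of the numerator. *)
Lemma quartic_root_slope (R : realType) (alpha psi x : R) :
  quartic_root_in_range alpha psi x <->
  [/\ 0 < (1 + x) / 2, (1 + x) / 2 < 1, (1 + x) / 2 < psi &
      slope psi ((1 + x) / 2) + 2 * alpha = 0].
Proof.
pose y := (1 + x) / 2; have xE : x = 2 * y - 1 by rewrite /y; field.
rewrite -/y /quartic_root_in_range lt_min xE quarticE.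
split=> [[x0 /andP[x1 xp] /eqP q0]|[y0 y1 yp]].
  have [y0 y1 yp] : [/\ 0 < y, y < 1 & y < psi] by split; lra.
  split=> //; rewrite slope_crit ?(ltW y0)//.
  by move: q0; rewrite mulf_eq0 pnatr_eq0 /= => /eqP ->; rewrite mulr0 mul0r.
rewrite slope_crit ?(ltW y0)// => /eqP.
rewrite mulf_eq0 invr_eq0 expf_eq0 /= (gt_eqF (sqrB_gt0 (ltW y0) y1 yp)) orbF.
rewrite mulf_eq0 pnatr_eq0 /= => /eqP ->.
by split; [lra|apply/andP; split; lra|rewrite mulr0].
Qed.

(** Equal slopes at distinct points would make the two strict tangent inequalities contradict each
    other. *)
Lemma slope_inj (R : realType) (psi y z : R) :
  0 <= y -> y < 1 -> y < psi -> 0 <= z -> z < 1 -> z < psi ->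
  slope psi y = slope psi z -> y = z.
Proof.
move=> y0 y1 yp z0 z1 zp e; apply/eqP/negPn/negP => yz.
have := ridge_tangent y0 y1 yp z0 z1 zp yz.
have := ridge_tangent z0 z1 zp y0 y1 yp; rewrite eq_sym => /(_ yz).
by rewrite e; lra.
Qed.

(** Intermediate values for the numerator of [slope_crit] on [[0, min(1, psi)]]. It is negative at 0
    because [alpha < 1]. At the right end the product [(1 - y) * (psi - y)] vanishes, and [psi != 1]
    keeps the remaining square positive. *)
Lemma slope_root (R : realType) (alpha psi : R) :
  0 < alpha -> alpha < 1 -> 0 < psi -> psi != 1 ->
  exists z, [/\ 0 < z, z < 1, z < psi & slope psi z + 2 * alpha = 0].
Proof.
move=> a0 a1 p0 pn1.
pose p : {poly R} := alpha *: (psi%:P - 'X ^+ 2) ^+ 2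
  - psi *: ((1 - 'X) * (psi%:P - 'X)).
have pE y : p.[y] = alpha * (psi - y ^+ 2) ^+ 2 - psi * (1 - y) * (psi - y).
  by rewrite /p !(hornerE, horner_exp).
pose m := Num.min 1 psi.
have m0 : 0 < m by rewrite lt_min ltr01.
have pm : 0 < p.[m].
  rewrite pE (_ : _ - _ = alpha * (psi - m ^+ 2) ^+ 2).
    rewrite mulr_gt0// exprn_even_gt0//= /m /Num.min; case: ifP => h.
      by rewrite expr1n subr_eq0.
    rewrite (_ : _ - _ = psi * (1 - psi)); last by ring.
    by apply: mulf_neq0; [rewrite gt_eqF|rewrite subr_eq0 eq_sym].
  by rewrite /m /Num.min; case: ifP => h; ring.
have pz : p.[0] < 0.
  rewrite pE (_ : _ - _ = (alpha - 1) * psi ^+ 2); last by ring.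
  by rewrite pmulr_llt0 ?exprn_gt0// subr_lt0.
have [z /andP[z0 zm] /rootP rz] : exists2 z, 0 <= z <= m & root p z.
  by apply: poly_ivt; rewrite ?ltW.
have {}z0 : 0 < z.
  by rewrite lt_neqAle z0 andbT; apply: contraTneq pz => e; move: rz; rewrite -e => ->; rewrite ltxx.
have {}zm : z < m.
  by rewrite lt_neqAle zm andbT; apply: contraTneq pm => e; rewrite -e rz ltxx.
have /andP[z1 zp] : (z < 1) && (z < psi) by rewrite -lt_min.
exists z; split=> //; rewrite slope_crit ?(ltW z0)// -pE rz.
by rewrite mulr0 mul0r.
Qed.

(** * Minimization over triples *)

Section Minimization.
Variables (R : realType) (alpha psi lambda F1 Fstar : R).
Hypotheses (alpha_ge0 : 0 <= alpha) (alpha_lt1 : alpha < 1).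
Hypotheses (psi_gt0 : 0 < psi) (lambda_gt0 : 0 < lambda) (F1_gt0 : 0 < F1).
Local Notation T := (R * R * R)%type.
Implicit Types t : T.

Local Notation obj := (objective_R3 alpha psi lambda F1 Fstar).
Local Notation y := (spectral psi lambda).

Definition profile (x : R) : R := ridge psi x + alpha * (2 * x - 1).

Definition objective_of (x : R) : R :=
  F1 ^+ 2 * profile x + (1 - alpha) * Fstar ^+ 2.

Lemma objective_le t : admissible t -> objective_of (y t) <= obj t.
Proof.
move=> at_; rewrite objective_R3E// lerD2r ler_wpM2l ?sqr_ge0// lerDl.
by rewrite mulr_ge0 ?subr_ge0 ?(ltW alpha_lt1)// excess_ge0.
Qed.

Lemma objective_eq t : mustar2 t = 0 -> obj t = objective_of (y t).
Proof.
move=> s0; have at_ : admissible t by rewrite /admissible /= s0.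
by rewrite objective_R3E// /objective_of /profile /excess s0 mulr0 !mul0r mulr0 addr0.
Qed.

Lemma objective_lt t : admissible t -> 0 < y t -> mustar2 t != 0 ->
  objective_of (y t) < obj t.
Proof.
move=> at_ y0 s0; rewrite objective_R3E// ltrD2r ltr_pM2l ?exprn_gt0//.
rewrite ltrDl mulr_gt0 ?subr_gt0// lt0r excess_ge0// andbT.
by apply: contra_neq s0; exact: excess_eq0.
Qed.

Lemma profile_tangent u z :
  0 <= u -> u < 1 -> u < psi -> 0 <= z -> z < 1 -> z < psi -> u != z ->
  profile z + (slope psi z + 2 * alpha) * (u - z) < profile u.
Proof.
move=> u0 u1 up z0 z1 zp uz; have := ridge_tangent u0 u1 up z0 z1 zp uz.
by rewrite /profile; lra.
Qed.

(** By convexity [z] is the only minimizer of [profile], so a minimizing triple has spectral value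
    [z]. As [z > 0], a nonzero [mustar2] would then cost a positive excess; with [mustar2] zero, the
    spectral equation is the stated condition. *)
Lemma minimizers_crit z : 0 < z -> z < 1 -> z < psi ->
  slope psi z + 2 * alpha = 0 ->
  minimizers_R3 alpha psi lambda F1 Fstar =
  [set t | mustar2 t = 0 /\
           mu1 t ^+ 2 * (psi - z) * (1 - z) = lambda * psi * z].
Proof.
move=> z0 z1 zp ez.
have [t0 [at0 s0 yt0]] := spectral_surj psi_gt0 lambda_gt0 (ltW z0) z1 zp.
have ot0 : obj t0 = objective_of z by rewrite objective_eq// yt0.
have zmin t : admissible t -> y t != z -> objective_of z < objective_of (y t).
  move=> at_ ytz; rewrite ltrD2r ltr_pM2l ?exprn_gt0//.
  have /(_ ytz) := profile_tangent (spectral_ge0 psi_gt0 lambda_gt0 at_)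
    (spectral_lt1 psi_gt0 lambda_gt0 at_) (spectral_lt_psi psi_gt0 lambda_gt0 at_) (ltW z0) z1 zp.
  by rewrite ez mul0r addr0.
apply/seteqP; split=> t /=.
  move=> [at_ /(_ _ at0)]; rewrite ot0 => le_t.
  have ytz : y t = z.
    apply: contraTeq le_t => /(zmin _ at_) h.
    by rewrite -ltNge (lt_le_trans h)// objective_le.
  have st : mustar2 t = 0.
    apply: contraTeq le_t => h; rewrite -ltNge -ytz objective_lt// ytz//.
  split=> //; rewrite -ytz spectral_eq// /shift st addr0//.
move=> [st et]; have at_ : admissible t by rewrite /admissible /= st.
split=> // s as_; rewrite objective_eq//.
have -> : y t = z by apply: spectral_uniq; rewrite ?(ltW z0)// /shift st addr0.
apply: le_trans (objective_le as_).
by have [->//|/(zmin _ as_)/ltW] := eqVneq (y s) z.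
Qed.

(** The tangent is taken at the right point [z], where slope and [u - z] are both nonpositive.
    Strictness comes from convexity, so a weak bound on the slope suffices. *)
Lemma profile_decreasing :
  (forall z, 0 <= z -> z < 1 -> z < psi -> slope psi z + 2 * alpha <= 0) ->
  forall u z, 0 <= u -> u < z -> z < 1 -> z < psi -> profile z < profile u.
Proof.
move=> h u z u0 uz z1 zp; have z0 : 0 <= z by lra.
have := profile_tangent u0 (lt_trans uz z1) (lt_trans uz zp) z0 z1 zp.
rewrite lt_eqF// => /(_ isT); apply: le_lt_trans.
by have := h _ z0 z1 zp; nra.
Qed.

Lemma minimizers_decreasing :
  (forall z, 0 <= z -> z < 1 -> z < psi -> slope psi z + 2 * alpha <= 0) ->
  minimizers_R3 alpha psi lambda F1 Fstar = set0.
Proof.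
move=> /profile_decreasing dec; apply/seteqP; split=> // t [at_ tmin].
have y0 := spectral_ge0 psi_gt0 lambda_gt0 at_.
have y1 := spectral_lt1 psi_gt0 lambda_gt0 at_.
have yp := spectral_lt_psi psi_gt0 lambda_gt0 at_.
pose m := Num.min 1 psi; have ym : y t < m by rewrite lt_min y1.
(* No spectral value reaches [m], so the midpoint is still realizable and gives a smaller
   objective. *)
pose z := (y t + m) / 2.
have yz : y t < z by rewrite /z; lra.
have : z < m by rewrite /z; lra.
rewrite lt_min => /andP[z1 zp].
have [t0 [at0 s0 yt0]] :=
  spectral_surj psi_gt0 lambda_gt0 (ltW (le_lt_trans y0 yz)) z1 zp.
have := tmin _ at0; rewrite leNgt => /negP; apply.
apply: lt_le_trans (objective_le at_); rewrite objective_eq// yt0.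
by rewrite ltrD2r ltr_pM2l ?exprn_gt0//; exact: dec.
Qed.

(** A crude bound whose purpose is to make the infimum finite in [objective_cvg_inf]. *)
Lemma objective_lb t : admissible t -> - F1 ^+ 2 <= obj t.
Proof.
move=> at_; apply: le_trans (objective_le at_).
have y0 := spectral_ge0 psi_gt0 lambda_gt0 at_.
have y1 := spectral_lt1 psi_gt0 lambda_gt0 at_.
have yp := spectral_lt_psi psi_gt0 lambda_gt0 at_.
rewrite /objective_of.
have h1 : 0 <= (1 - alpha) * Fstar ^+ 2.
  by rewrite mulr_ge0 ?sqr_ge0// subr_ge0 ltW.
have h2 : -1 <= profile (y t).
  have : 0 <= ridge psi (y t).
    rewrite divr_ge0 ?(ltW (sqrB_gt0 y0 y1 yp))//.
    by rewrite mulr_ge0 ?sqr_ge0// ltW.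
  rewrite /profile => r0; have := mulr_ge0 alpha_ge0 y0.
  move: (y t) (ridge _ _) r0 => z r r0 az.
  by move: alpha_lt1; nra.
apply: (@le_trans _ _ (F1 ^+ 2 * -1)); first by rewrite mulrN1.
by rewrite ler_wpDr// ler_wpM2l ?sqr_ge0.
Qed.

Lemma spectral_near (u : nat -> T) z : 0 <= z -> z < 1 -> z < psi ->
  (forall n, mustar2 (u n) = 0) -> mu1 (u n) @[n --> \oo] --> +oo%R ->
  \forall n \near \oo, z < y (u n).
Proof.
move=> z0 z1 zp su mu.
have k0 : 0 < (psi - z) * (1 - z) by rewrite mulr_gt0 ?subr_gt0.
pose a := lambda * psi * z / ((psi - z) * (1 - z)).
have a0 : 0 <= a.
  by rewrite divr_ge0 ?(ltW k0)// !mulr_ge0// ltW.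
near=> n.
(* At [mu1 ^+ 2 = a] the spectral value would be exactly [z]. Since [a >= 0], this bound implies
   [a < mu1 (u n) ^+ 2]. *)
have an : a + 1 < mu1 (u n) by near: n; move/cvgryPgt: mu; exact.
apply: spectral_lt => //; first by rewrite /admissible /= su.
rewrite /shift su addr0 -[ltRHS]mulrA -ltr_pdivrMr// -/a.
by move: (mu1 _) (a) a0 an => m c c0 cm; nra.
Unshelve. all: by end_near. Qed.

Lemma objective_cvg_inf (u : nat -> T) :
  (forall z, 0 <= z -> z < 1 -> z < psi -> slope psi z + 2 * alpha <= 0) ->
  (forall n, mustar2 (u n) = 0) -> mu1 (u n) @[n --> \oo] --> +oo%R ->
  (obj (u n))%:E @[n --> \oo]
    --> ereal_inf [set (obj t)%:E | t in @admissible R].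
Proof.
move=> /profile_decreasing dec su mu.
set S := [set _ | _ in _].
have au n : admissible (u n) by rewrite /admissible /= su.
have Ilb t : admissible t -> (ereal_inf S <= (obj t)%:E)%E.
  by move=> at_; apply: ereal_inf_lbound; exists t.
have If : ereal_inf S \is a fin_num.
  rewrite fin_numE; apply/andP; split.
    rewrite gt_eqF// (@lt_le_trans _ _ (- F1 ^+ 2)%:E) ?ltNyr//.
    by apply: le_ereal_inf_tmp => _ [t at_ <-]; rewrite lee_fin objective_lb.
  by rewrite lt_eqF// (le_lt_trans (Ilb _ (au 0%N)))// ltry.
rewrite -(fineK If); apply: cvg_EFin; first exact: nearW.
apply/cvgrPdist_lt => e e0.
(* Once the spectral value of [u n] passes that of this nearly optimal [t], monotonicity puts
   [obj (u n)] between the infimum and [obj t]. *)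
have [_ [t at_ <-] te] := lb_ereal_inf_adherent e0 If.
have y0 := spectral_ge0 psi_gt0 lambda_gt0 at_.
have y1 := spectral_lt1 psi_gt0 lambda_gt0 at_.
have yp := spectral_lt_psi psi_gt0 lambda_gt0 at_.
near=> n.
have yn : y t < y (u n) by near: n; exact: spectral_near.
have ln : obj (u n) < obj t.
  apply: lt_le_trans (objective_le at_); rewrite objective_eq//.
  rewrite ltrD2r ltr_pM2l ?exprn_gt0//; apply: dec => //.
  - exact: spectral_lt1.
  - exact: spectral_lt_psi.
move: te (Ilb _ (au n)); rewrite -(fineK If) -EFinD lte_fin lee_fin /= => te In.
by rewrite ltr_norml; apply/andP; split; lra.
Unshelve. all: by end_near. Qed.

End Minimization.

Theorem theorem11 (R : realType) (alpha psi1 lambda F1 Fstar tau : R)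
    (alpha_ge0 : 0 <= alpha) (alpha_lt1 : alpha < 1)
    (psi1_gt0 : 0 < psi1) (lambda_gt0 : 0 < lambda)
    (F1_gt0 : 0 < F1) (Fstar_ge0 : 0 <= Fstar) (tau_ge0 : 0 <= tau) :
  let obj := objective_R3 alpha psi1 lambda F1 Fstar in
  let U := minimizers_R3 alpha psi1 lambda F1 Fstar in
  [/\ (* (i) *)
      alpha = 0 \/ (psi1 = 1 /\ 0 < alpha /\ alpha <= 4^-1) ->
        U = set0 /\
        (forall u : nat -> R * R * R,
           (forall n, mustar2 (u n) = 0) ->
           mu1 (u n) @[n --> \oo] --> +oo%R ->
           (obj (u n))%:E @[n --> \oo]
             --> ereal_inf [set (obj t)%:E | t in @admissible R]),
      (* (ii) *)
      psi1 = 1 /\ 4^-1 < alpha ->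
        U = [set t | mustar2 t = 0 /\
               mu1 t ^+ 2 =
                 (- 4 * alpha ^+ 2 * lambda + 3 * alpha * lambda
                    + Num.sqrt alpha * lambda)
                 / (16 * alpha ^+ 2 - 8 * alpha + 1)]
    & (* (iii) *)
      psi1 <> 1 /\ 0 < alpha ->
        exists x : R,
          unique (quartic_root_in_range alpha psi1) x /\
          U = [set t | mustar2 t = 0 /\
                 mu1 t ^+ 2 * (- 1 + 2 * psi1 - x) * (- 1 + x)
                   + 2 * lambda * psi1 * (1 + x) = 0]].
Proof.
move=> obj U; split.
- move=> h.
  have slope_le z : 0 <= z -> z < 1 -> z < psi1 ->
      slope psi1 z + 2 * alpha <= 0.
    move=> z0 z1 zp; rewrite slope_crit// mulr_le0_ge0 ?invr_ge0 ?sqr_ge0//.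
    rewrite pmulr_rle0// subr_le0; case: h => [->|[p1 [_ a4]]].
      by rewrite mul0r mulr_ge0 ?mulr_ge0//; lra.
    (* For [psi1 = 1] the claim reduces to [alpha * (1 + z) ^+ 2 <= 1], which follows from
       [alpha <= 4^-1] and [z < 1]. *)
    rewrite p1 mul1r (_ : (1 - z ^+ 2) ^+ 2 = (1 + z) ^+ 2 * ((1 - z) * (1 - z)));
      last by ring.
    rewrite mulrA ler_piMl//; first by rewrite mulr_ge0//; lra.
    apply: (@le_trans _ _ (4^-1 * 2 ^+ 2)); last by lra.
    by apply: ler_pM; rewrite ?sqr_ge0// ler_sqr ?nnegrE; lra.
  split; first exact: minimizers_decreasing.
  by move=> u su mu; exact: objective_cvg_inf.
- move=> [p1 a4]; rewrite /U p1.
  have r0 : 0 < Num.sqrt alpha by rewrite sqrtr_gt0; lra.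
  have r2 : alpha = Num.sqrt alpha ^+ 2 by rewrite sqr_sqrtr.
  set r := Num.sqrt alpha in r0 r2 *.
  have r12 : 1 < 2 * r by nra.
  have r1 : r < 1 by nra.
  have rn0 : r != 0 by rewrite gt_eqF.
  have rn1 : 2 * r - 1 != 0 by rewrite subr_eq0 gt_eqF.
  have rn2 : 2 * r + 1 != 0 by rewrite gt_eqF//; lra.
  (* For [psi1 = 1] the critical equation is [alpha * (1 + z) ^+ 2 = 1], whence [z = r^-1 - 1]; it
     lies in [(0, 1)] because [1 / 2 < r < 1]. *)
  have z0 : 0 < r^-1 - 1 by rewrite subr_gt0 invf_gt1.
  have z1 : r^-1 - 1 < 1.
    by rewrite ltrBlDr -(ltr_pM2r r0) mulVf//; lra.
  rewrite (minimizers_crit Fstar alpha_lt1 ltr01 lambda_gt0 F1_gt0 z0 z1 z1).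
    apply: eq_set => t; congr (_ /\ _); apply/propext.
    (* Numerator and denominator share the factor [(2 * r + 1) ^+ 2]. What remains solves
       [mu1 ^+ 2 * (1 - z) ^+ 2 = lambda * z] with [1 - z = (2 * r - 1) / r]. *)
    have -> : 16 * alpha ^+ 2 - 8 * alpha + 1 =
        ((2 * r - 1) * (2 * r + 1)) ^+ 2 by rewrite r2; ring.
    have -> : - 4 * alpha ^+ 2 * lambda + 3 * alpha * lambda + r * lambda =
        lambda * r * (1 - r) * (2 * r + 1) ^+ 2 by rewrite r2; ring.
    have k : (2 * r - 1) / r != 0 by rewrite mulf_neq0// invr_eq0.
    split=> e; last by rewrite e; field; rewrite rn0 rn1 rn2.
    apply: (mulIf (expf_neq0 2 k)).
    transitivity (mu1 t ^+ 2 * (1 - (r^-1 - 1)) * (1 - (r^-1 - 1))).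
      by field.
    by rewrite e; field; rewrite rn0 rn1 rn2.
  rewrite slope_crit ?(ltW z0)// r2.
  rewrite (_ : _ - _ * _ * _ = 0) ?mulr0 ?mul0r//; by field.
- move=> [/eqP pn1 a0].
  have [z [z0 z1 zp ez]] := slope_root a0 alpha_lt1 psi1_gt0 pn1.
  have zE : (1 + (2 * z - 1)) / 2 = z by field.
  exists (2 * z - 1); split.
    split; first by apply/quartic_root_slope; rewrite zE.
    move=> x /quartic_root_slope[x0 x1 xp ex].
    (* Both slopes equal [- 2 * alpha], so uniqueness is injectivity of the slope. *)
    have : slope psi1 z = slope psi1 ((1 + x) / 2) by lra.
    by move=> /(slope_inj (ltW z0) z1 zp (ltW x0) x1 xp) ->; field.
  rewrite /U (minimizers_crit Fstar alpha_lt1 psi1_gt0 lambda_gt0 F1_gt0 z0 z1 zp ez).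
  apply: eq_set => t; congr (_ /\ _); apply/propext.
  have -> : mu1 t ^+ 2 * (- 1 + 2 * psi1 - (2 * z - 1)) * (- 1 + (2 * z - 1))
      + 2 * lambda * psi1 * (1 + (2 * z - 1)) =
      - 4 * (mu1 t ^+ 2 * (psi1 - z) * (1 - z) - lambda * psi1 * z) by ring.
  split=> [->|/eqP]; first by rewrite subrr mulr0.
  by rewrite mulf_eq0 oppr_eq0 pnatr_eq0 /= subr_eq0 => /eqP.
Qed.
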